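(* Let $H$ be a complex Hilbert space with inner product $(\cdot,\cdot)$, let $J\in\mathcal{L}(H)$ with $J^*=J$ and suppose $1$ and $-1$ are eigenvalues for $J$. Then the group $G$ of linear biholomorphic mappings of $$\mathcal{D}=\{z\in H:(Jz,z)<0\}$$ acts transitively on $\mathcal{D}$.
   Context: $\mathcal{L}(H)$ is the space of bounded linear operators on $H$. The linear biholomorphic mappings of $\mathcal{D}$ are the biholomorphic mappings of $\mathcal{D}$ onto itself (holomorphic bijections with holomorphic inverse) which are restrictions of bounded linear maps of $H$ into itself. *)

(* Defs.v *)
(* MathComp / MathComp-Analysis *)
From mathcomp Require Import all_boot all_order all_algebra.
From mathcomp Require Import all_classical all_reals all_analysis.
From mathcomp Require Import complex.
Set Implicit Arguments.
Unset Strict Implicit.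
Unset Printing Implicit Defensive.
Import Order.TTheory GRing.Theory Num.Theory numFieldNormedType.Exports.
Local Open Scope classical_set_scope.
Local Open Scope ring_scope.

(* A complex Hilbert space is a complete normed space over R[i], where R is the
   field of real numbers, with a positive definite Hermitian form [dot] (linear
   on the left, conjugate-linear on the right) that induces its norm. *)
Definition is_hilbert_dot (R : realType) (H : completeNormedModType R[i])
    (dot : {dot H for Num.conj}) : Prop :=
  forall x : H, `|x| = sqrtC (dot x x).

Definition bounded_operator (R : realType) (H : normedModType R[i])
    (A : {linear H -> H}) : Prop :=
  exists M : R[i], forall x : H, `|A x| <= M * `|x|.

(* B = A^* *)
Definition is_adjoint (R : realType) (H : normedModType R[i])
    (dot : {dot H for Num.conj}) (A B : H -> H) : Prop :=
  forall x y : H, dot (A x) y = dot x (B y).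

Definition is_eigenvalue (R : realType) (H : lmodType R[i])
    (A : H -> H) (a : R[i]) : Prop :=
  exists2 v : H, v != 0 & A v = a *: v.

(* The order of R[i] makes [dot (J z) z < 0] say that [dot (J z) z] is real and
   negative. *)
Definition neg_domain (R : realType) (H : normedModType R[i])
    (dot : {dot H for Num.conj}) (J : H -> H) : set H :=
  [set z | dot (J z) z < 0].

(* Complex Frechet differentiability at each point of D, which is meant to be
   open. A map on D is represented by a function on H; its values outside D
   play no role here, nor in the definitions below. *)
Definition holomorphic_on (R : realType) (H : normedModType R[i])
    (D : set H) (f : H -> H) : Prop :=
  forall z, D z -> differentiable f z.

Definition biholomorphic_self_map (R : realType) (H : normedModType R[i])
    (D : set H) (g : H -> H) : Prop :=
  [/\ set_bij D D g, holomorphic_on D g &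
      exists h : H -> H, holomorphic_on D h /\
        (forall z, D z -> h (g z) = z)].

Definition linear_biholomorphic_maps (R : realType) (H : normedModType R[i])
    (D : set H) : set (H -> H) :=
  [set g | biholomorphic_self_map D g /\
     exists L : {linear H -> H},
       bounded_operator L /\ (forall z, D z -> g z = L z)].

Definition transformation_group (T : Type) (D : set T) (G : set (T -> T)) :
    Prop :=
  [/\ forall g, G g -> set_bij D D g,
      G idfun,
      forall g h, G g -> G h -> G (g \o h) &
      forall g, G g -> exists2 h, G h & forall z, D z -> h (g z) = z].

Definition acts_transitively (T : Type) (D : set T) (G : set (T -> T)) :
    Prop :=
  forall z w, D z -> D w -> exists2 g, G g & g z = w.

(* Main.v *)
From HB Require Import structures.
Require Import Defs.
From mathcomp Require Import all_boot all_order all_algebra.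
From mathcomp Require Import all_classical all_reals all_analysis.
From mathcomp Require Import complex.
From mathcomp Require Import ring.
Set Implicit Arguments.
Unset Strict Implicit.
Unset Printing Implicit Defensive.
Import Order.TTheory GRing.Theory Num.Theory numFieldNormedType.Exports.
Local Open Scope classical_set_scope.
Local Open Scope ring_scope.

(** Write B(x, y) for the Hermitian form (J x, y) and q(x) = B(x, x), a real
    number, so that D is the set where q < 0.

    Transitivity.  For v with q(v) != 0 the reflection
    x |-> x - (2 B(x, v) / q(v)) v is a bounded linear involution that preserves
    q, hence an element of G; so is every nonzero homothety, since it
    multiplies q by a positive number.  Given z and w in D, rescale w to u = a w
    with q(u) = q(z) and B(z, u) >= 0 ([normalizing_scalar]).  When B(z, u) is
    real and q(u) = q(z), reflecting along z - u exchanges z and u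
    ([reflection_swap]), provided that q(z - u) = 2 (q(z) - B(z, u)) is nonzero;
    here it is negative because q(z) < 0 <= B(z, u).  Following this reflection
    by the homothety of ratio a^-1 sends z to w.

    Group structure.  The only point that is not formal is that the inverse of
    an element of G is again the restriction of a bounded linear map.  If g is
    the restriction of the bounded linear A and h is its holomorphic inverse,
    then h o A is the identity on the nonempty open set D, so by the chain rule
    the derivative M of h at a point of g(D) is a bounded linear map with
    M o A = id on all of H ([linear_left_inverse_derivative]).  Since g maps D
    onto D, h agrees with M on D.  This uses that D is open, which follows from
    the boundedness of J, and nonempty, which the eigenvalue -1 provides. *)

(** * Inner products and bounded operators *)

(** The inner product of u - (form u v / form v v) v, the component of u
    orthogonal to v, with itself is nonnegative. *)
Lemma cauchy_schwarz (C : numClosedFieldType) (U : lmodType C)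
    (form : {dot U for Num.conj}) (u v : U) :
  `|form u v| ^+ 2 <= form u u * form v v.
Proof.
have [->|v0] := eqVneq v 0.
  have -> : form u 0 = 0 by exact: linear0r.
  by rewrite normr0 expr0n mulr_ge0 // dnorm_ge0.
have d_gt0 : 0 < form v v by rewrite dnorm_gt0.
have d0 := lt0r_neq0 d_gt0.
set b := form u v; set d := form v v in d0 d_gt0 *.
have kconj : (b / d)^* = b^* / d.
  by rewrite rmorphM /= fmorphV /=; congr (_ / _); apply/CrealP/gtr0_real.
have := dnorm_ge0 form (u - (b / d) *: v).
rewrite dnormB dnormZ linearZr_LR /= -/b -/d !normCK.
rewrite [((b / d)^* * b)^*]rmorphM /= conjCK kconj.
have -> : form u u + b / d * (b^* / d) * d - (b^* / d * b + b / d * b^*)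
          = form u u - b * b^* / d by field.
by rewrite subr_ge0 ler_pdivrMr.
Qed.

Lemma hilbert_dot_le (R : realType) (H : completeNormedModType R[i])
    (dot : {dot H for Num.conj}) (hdot : is_hilbert_dot dot) (x y : H) :
  `|dot x y| <= `|x| * `|y|.
Proof.
rewrite -(@ler_pXn2r _ 2) ?nnegrE ?mulr_ge0 ?normr_ge0 //.
by rewrite exprMn !hdot !sqrtCK cauchy_schwarz.
Qed.

(** The order of R[i] is partial, and a bound M need not even be real when H is
    trivial; its modulus is still a bound. *)
Lemma bounded_operator_ge0 (R : realType) (H : normedModType R[i])
    (A : {linear H -> H}) :
  bounded_operator A ->
  exists2 M : R[i], 0 <= M & forall x, `|A x| <= M * `|x|.
Proof.
case=> M AM; exists `|M| => // x.
have Mx_ge0 : 0 <= M * `|x| by apply: le_trans (AM x).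
by rewrite -[`|x|]normr_id -normrM ger0_norm.
Qed.

Lemma bounded_operatorP (R : realType) (H : normedModType R[i])
    (A : {linear H -> H}) : bounded_operator A <-> continuous A.
Proof.
rewrite -linear_bounded_continuous linear_boundedP; split.
  move=> /bounded_operator_ge0[M M_ge0 AM]; exists M; split.
    exact: ger0_real.
  move=> N MN x; apply: le_trans (AM x) _.
  by rewrite ler_wpM2r // ltW.
case=> M [Mreal AM]; exists (M + 1) => x.
by apply: AM; rewrite ltrDl.
Qed.

(** * The domain where the form is negative *)

Lemma selfadjoint_form_conj (R : realType) (H : normedModType R[i])
    (dot : {dot H for Num.conj}) (J : H -> H) (x y : H) :
  is_adjoint dot J J -> dot (J x) y = (dot (J y) x)^*.
Proof. by move=> JJ; rewrite JJ hermC expr0 mul1r. Qed.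

Lemma selfadjoint_form_real (R : realType) (H : normedModType R[i])
    (dot : {dot H for Num.conj}) (J : H -> H) (x : H) :
  is_adjoint dot J J -> dot (J x) x \is Num.real.
Proof. by move=> JJ; apply/CrealP; rewrite -selfadjoint_form_conj. Qed.

(** The negative numbers are not open in R[i], so continuity of the form is not
    enough: its increments have to be compared as real numbers, and they are
    real because J is self-adjoint. *)
Lemma neg_domain_open (R : realType) (H : completeNormedModType R[i])
    (dot : {dot H for Num.conj}) (hdot : is_hilbert_dot dot)
    (J : {linear H -> H}) :
  bounded_operator J -> is_adjoint dot J J -> open (neg_domain dot J).
Proof.
move=> /bounded_operator_ge0[M M_ge0 JM] JJ; rewrite openE => z /= z_neg.
have formM (x y : H) : `|dot (J x) y| <= M * `|x| * `|y|.
  by apply: le_trans (hilbert_dot_le hdot _ _) _; rewrite ler_wpM2r.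
set q := - dot (J z) z; set c := M * `|z| + M * `|z| + M.
have c_ge0 : 0 <= c by rewrite /c !addr_ge0 ?mulr_ge0.
have q_gt0 : 0 < q by rewrite oppr_gt0.
have qc_gt0 : 0 < q + c by rewrite ltr_pwDl.
(* An increment h changes (J z, z) = - q by at most c |h| if |h| <= 1, so one
   needs |h| <= 1 and c |h| < q.  The radius q / (q + c) ensures both and avoids
   a minimum in R[i]. *)
apply/nbhs_normP; exists (q / (q + c)) => [|y] /=; first exact: divr_gt0.
rewrite -normrN opprB => h_small.
have h_le1 : `|y - z| <= 1.
  apply: ltW (lt_le_trans h_small _).
  by rewrite ler_pdivrMr // mul1r lerDl.
rewrite -[y](subrK z); set h := y - z in h_small h_le1 *.
have h_ltq : c * `|h| < q.
  rewrite ltr_pdivlMr // in h_small; apply: le_lt_trans h_small.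
  by rewrite mulrC ler_wpM2l // lerDr ltW.
rewrite /neg_domain /=.
set r := dot (J h) z + dot (J z) h + dot (J h) h.
have formE : dot (J (h + z)) (h + z) = r - q.
  by rewrite /r /q opprK [J (h + z)]linearD /= linearDl !linearDr /=; ring.
have r_real : r \is Num.real.
  have -> : r = dot (J (h + z)) (h + z) - dot (J z) z.
    by rewrite formE /q opprK addrK.
  by rewrite rpredB ?selfadjoint_form_real.
rewrite formE subr_lt0; apply: le_lt_trans h_ltq.
apply: le_trans (real_ler_norm r_real) _.
apply: le_trans (ler_normD _ _) _.
apply: le_trans (lerD (ler_normD _ _) (lexx _)) _.
rewrite /c !mulrDl; apply: lerD; last first.
  apply: le_trans (formM _ _) _.
  by rewrite -mulrA ler_wpM2l // ler_piMl.
apply: lerD; last exact: formM.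
by rewrite mulrAC; apply: formM.
Qed.

(** * The group of linear biholomorphic maps of an open set *)

Lemma bounded_linear_differentiable (R : realType) (H : normedModType R[i])
    (A : {linear H -> H}) (z : H) : bounded_operator A -> differentiable A z.
Proof. by move=> /bounded_operatorP Ac; apply: linear_differentiable. Qed.

(** A differentiable left inverse of A on an open set yields, by the chain rule,
    a continuous linear left inverse of A on the whole space. *)
Lemma linear_left_inverse_derivative (K : numFieldType)
    (V W : normedModType K) (D : set V) (A : {linear V -> W}) (h : W -> V)
    (z : V) :
  open D -> D z -> continuous A -> differentiable h (A z) ->
  (forall x, D x -> h (A x) = x) -> forall x, 'd h (A z) (A x) = x.
Proof.
move=> Dopen Dz Ac hdiff hA x.
have Adiff : differentiable A z by apply: linear_differentiable.
have near_id : \near z, (h \o A) z = id z.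
  by apply: filterS (open_nbhs_nbhs (conj Dopen Dz)) => y /hA.
have := near_eq_derive x near_id.
rewrite derive_id deriveE; last exact: differentiable_comp.
by rewrite diff_comp //= diff_lin.
Qed.

(** The inverse of an element that is the restriction of A is the restriction of
    the derivative of its holomorphic inverse at a point A z0 with z0 in D. *)
Lemma linear_biholomorphic_maps_group (R : realType) (H : normedModType R[i])
    (D : set H) :
  open D -> D !=set0 -> transformation_group D (linear_biholomorphic_maps D).
Proof.
move=> Dopen [z0 Dz0]; split.
- by move=> g [[]].
- have id_bounded : @bounded_operator R H idfun by exists 1 => x; rewrite mul1r.
  have id_diff : holomorphic_on D idfun.
    by move=> z _; apply: (bounded_linear_differentiable z id_bounded).
  split; last by exists idfun.
  by split; [split=> // x Dx; exists x | | exists idfun].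
- move=> g h [[gD gdiff [g' [g'diff gK]]] [A [Ab gA]]].
  move=> [[hD hdiff [h' [h'diff hK]]] [B [Bb hB]]].
  have hDD z : D z -> D (h z) by case: hD => + _ _; apply.
  split; last first.
    exists (A \o B); split; last first.
      by move=> z Dz /=; rewrite hB // gA -?hB //; apply: hDD.
    rewrite bounded_operatorP; move: Ab Bb; rewrite !bounded_operatorP => Ac Bc.
    by move=> x; apply: continuous_comp; [exact: Bc|exact: Ac].
  split; first exact: set_bij_comp hD gD.
    by move=> z Dz; apply: differentiable_comp; [exact: hdiff|exact/gdiff/hDD].
  exists (h' \o g'); split; last by move=> z Dz /=; rewrite gK ?hK //; apply: hDD.
  move=> z Dz; apply: differentiable_comp; first exact: g'diff.
  apply: h'diff; case: gD => _ _ /(_ z Dz) [x Dx <-]; by rewrite gK.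
- move=> g [[gD gdiff [h [hdiff gK]]] [A [Ab gA]]]; exists h => //.
  have gDD z : D z -> D (g z) by case: gD => + _ _; apply.
  have hg z : D z -> D (h z) /\ g (h z) = z.
    by move=> Dz; case: gD => _ _ /(_ z Dz) [x Dx <-]; rewrite gK.
  have hD : set_bij D D h.
    split=> [z /hg[]//|x y /set_mem/hg[_ gx] /set_mem/hg[_ gy] hxy|z Dz].
      by rewrite -gx hxy.
    by exists (g z); [exact: gDD | exact: gK].
  have hdiff0 : differentiable h (A z0) by rewrite -gA //; apply/hdiff/gDD.
  split; first by split=> //; exists g; split=> // z /hg[].
  exists ('d h (A z0)); split; first exact/bounded_operatorP/diff_continuous.
  move=> z Dz; have [Dhz {2}<-] := hg z Dz; rewrite gA //.
  rewrite (linear_left_inverse_derivative Dopen Dz0) //.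
    exact/bounded_operatorP.
  by move=> x Dx; rewrite -gA ?gK.
Qed.

Lemma linear_biholomorphic_mapsI (R : realType) (H : normedModType R[i])
    (D : set H) (A B : {linear H -> H}) :
  bounded_operator A -> bounded_operator B ->
  (forall z, D z -> D (A z)) -> (forall z, D z -> D (B z)) ->
  cancel A B -> cancel B A ->
  linear_biholomorphic_maps D A.
Proof.
move=> Ab Bb AD BD AK BK; split; last by exists A.
split.
- split=> [z /AD//|x y _ _ /(can_inj AK)//|z Dz].
  by exists (B z); [exact: BD | exact: BK].
- by move=> z _; apply: bounded_linear_differentiable.
- exists B; split=> [z _|z _]; last exact: AK.
  exact: bounded_linear_differentiable.
Qed.

(** * Reflections for an indefinite Hermitian form *)

Section Reflection.
Context (R : realType) (H : completeNormedModType R[i]).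
Context (dot : {dot H for Num.conj}) (J : {linear H -> H}).

Definition reflection (v x : H) : H :=
  x - (2 * dot (J x) v / dot (J v) v) *: v.

Fact reflection_is_linear (v : H) : linear (reflection v).
Proof.
move=> a x y; rewrite /reflection [J _]linearP /=.
rewrite (linearDl dot) (linearZl_LR dot) /=.
set p := dot (J x) v; set q := dot (J y) v; set d := dot (J v) v.
have -> : 2 * (a * p + q) / d = a * (2 * p / d) + 2 * q / d by ring.
by rewrite scalerDl scalerBr scalerA opprD addrACA.
Qed.

HB.instance Definition _ (v : H) :=
  GRing.isLinear.Build R[i] H H _ (reflection v) (reflection_is_linear v).

Lemma reflection_bounded (v : H) :
  is_hilbert_dot dot -> bounded_operator J -> bounded_operator (reflection v).
Proof.
move=> hdot [M JM]; set d := dot (J v) v.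
exists (1 + `|2 / d| * M * `|v| ^+ 2) => x.
have form_le : `|dot (J x) v| <= M * `|x| * `|v|.
  by apply: le_trans (hilbert_dot_le hdot _ _) _; rewrite ler_wpM2r.
have -> : (1 + `|2 / d| * M * `|v| ^+ 2) * `|x|
          = `|x| + `|2 / d| * (M * `|x| * `|v|) * `|v| by ring.
apply: le_trans (ler_normB _ _) _; rewrite lerD2l normrZ.
by rewrite mulrAC normrM -/d ler_wpM2r // ler_wpM2l.
Qed.

(** The reflection negates the component along v: B(reflection v x, v) is
    - B(x, v), so the second correction term cancels the first. *)
Lemma reflectionK (v : H) : dot (J v) v != 0 -> involutive (reflection v).
Proof.
move=> v0 x; rewrite {1}/reflection.
have -> : dot (J (reflection v x)) v = - dot (J x) v.
  rewrite [J _]linearB [J (_ *: _)]linearZ /=.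
  by rewrite (linearBl dot) (linearZl_LR dot) /=; field.
by rewrite /reflection mulrN mulNr scaleNr opprK subrK.
Qed.

Lemma reflection_isometry (v x : H) : is_adjoint dot J J ->
  dot (J v) v != 0 ->
  dot (J (reflection v x)) (reflection v x) = dot (J x) x.
Proof.
move=> JJ v0; rewrite /reflection; set k := _ / _.
have kconj : k^* = 2 * dot (J v) x / dot (J v) v.
  by rewrite /k !rmorphM /= fmorphV /= -!selfadjoint_form_conj // conjC_nat.
rewrite [J _]linearB [J (_ *: _)]linearZ /= (linearBl dot) !(linearBr dot) /=.
rewrite !(linearZl_LR dot) !(linearZr_LR dot) /= kconj /k.
by field.
Qed.

Lemma form_sub_diag (z u : H) :
  dot (J u) u = dot (J z) z -> dot (J u) z = dot (J z) u ->
  dot (J (z - u)) (z - u) = 2 * (dot (J z) z - dot (J z) u).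
Proof.
move=> uu uz.
rewrite [J _]linearB (linearBl dot) !(linearBr dot) /= uu uz; ring.
Qed.

(** Under these hypotheses q(z - u) = 2 B(z, z - u), so the coefficient of z - u
    in the reflection of z is 1. *)
Lemma reflection_swap (z u : H) :
  dot (J u) u = dot (J z) z -> dot (J u) z = dot (J z) u ->
  dot (J z) u != dot (J z) z -> reflection (z - u) z = u.
Proof.
move=> uu uz zu; rewrite /reflection form_sub_diag // (linearBr dot) /=.
rewrite divff ?scale1r ?subKr //.
by rewrite mulf_neq0 ?pnatr_eq0 // subr_eq0 eq_sym.
Qed.

End Reflection.

(** * Transitivity *)

(** The modulus of a is determined by the first equation; its phase is the phase
    of B(z, w), or anything if B(z, w) = 0. *)
Lemma normalizing_scalar (R : realType) (H : completeNormedModType R[i])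
    (dot : {dot H for Num.conj}) (J : {linear H -> H}) (z w : H) :
  dot (J z) z < 0 -> dot (J w) w < 0 ->
  exists a : R[i], [/\ a != 0, dot (J (a *: w)) (a *: w) = dot (J z) z &
                       0 <= dot (J z) (a *: w)].
Proof.
move=> z_neg w_neg; set b := dot (J z) w.
set r := sqrtC (dot (J z) z / dot (J w) w).
have r2_gt0 : 0 < dot (J z) z / dot (J w) w by rewrite nmulr_rgt0 ?invr_lt0.
have r_gt0 : 0 < r by rewrite sqrtC_gt0.
have [p p1 pb] : exists2 p : R[i], `|p| = 1 & 0 <= p^* * b.
  have [->|b0] := eqVneq b 0; first by exists 1; rewrite ?normr1 ?mulr0.
  exists (b / `|b|); first by rewrite normrM normfV normr_id divff // normr_eq0.
  rewrite rmorphM fmorphV /= conj_normC.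
  by rewrite mulrAC [b^* * b]mulrC -normCK divr_ge0 ?exprn_ge0.
exists (r * p); split.
- by rewrite mulf_neq0 ?(lt0r_neq0 r_gt0) // -normr_eq0 p1 oner_eq0.
- rewrite [J _]linearZ /= (linearZl_LR dot) (linearZr_LR dot) /= mulrA -normCK.
  rewrite normrM p1 mulr1 gtr0_norm // sqrtCK divfK //.
  by rewrite ltr0_neq0.
- rewrite (linearZr_LR dot) /= rmorphM /= -mulrA mulr_ge0 //.
  by rewrite (CrealP _) ?ltW // gtr0_real.
Qed.

Theorem proposition12 (R : realType) (H : completeNormedModType R[i])
    (dot : {dot H for Num.conj}) (hdot : is_hilbert_dot dot)
    (J : {linear H -> H}) (J_bounded : bounded_operator J)
    (J_selfadjoint : is_adjoint dot J J)
    (J_eig1 : is_eigenvalue J 1) (J_eigN1 : is_eigenvalue J (-1)) :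
  let D := neg_domain dot J in
  let G := linear_biholomorphic_maps D in
  transformation_group D G /\ acts_transitively D G.
Proof.
move=> D G.
have D_neq0 : D !=set0.
  case: J_eigN1 => v v0 Jv; exists v.
  by rewrite /D /neg_domain /= Jv (linearZl_LR dot) /= mulN1r oppr_lt0 dnorm_gt0.
have DG := linear_biholomorphic_maps_group
  (neg_domain_open hdot J_bounded J_selfadjoint) D_neq0.
split=> // z w Dz Dw; have [_ _ G_comp _] := DG.
have [a [a0 aw_eq aw_ge0]] := normalizing_scalar Dz Dw.
set u := a *: w in aw_eq aw_ge0; set v := z - u.
have uz : dot (J u) z = dot (J z) u.
  by rewrite selfadjoint_form_conj // (CrealP _) // ger0_real.
have zu : dot (J z) u != dot (J z) z.
  by rewrite eq_sym lt_eqF // (lt_le_trans Dz).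
have v0 : dot (J v) v != 0.
  by rewrite form_sub_diag // mulf_neq0 ?pnatr_eq0 // subr_eq0 eq_sym.
have reflG : G (reflection dot J v).
  have reflD x : D x -> D (reflection dot J v x).
    by rewrite /D /neg_domain /= reflection_isometry.
  have reflb := reflection_bounded v hdot J_bounded.
  exact: (linear_biholomorphic_mapsI reflb reflb reflD reflD
    (reflectionK v0) (reflectionK v0)).
have scaleG : G ( *:%R a^-1).
  have scaleb (b : R[i]) : @bounded_operator R H ( *:%R b).
    by exists `|b| => x; rewrite normrZ.
  have scaleD (b : R[i]) x : b != 0 -> D x -> D (b *: x).
    move=> b0; rewrite /D /neg_domain /= [J (b *: x)]linearZ (linearZl_LR dot) /=.
    rewrite (linearZr_LR dot) /= mulrA -normCK => xD.
    by rewrite pmulr_rlt0 // exprn_gt0 // normr_gt0.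
  apply: (linear_biholomorphic_mapsI (scaleb a^-1) (scaleb a)) => [x|x||].
  - by apply: scaleD; rewrite invr_eq0.
  - exact: scaleD.
  - exact: scalerKV.
  - exact: scalerK.
exists ( *:%R a^-1 \o reflection dot J v); first exact: G_comp.
by rewrite /= reflection_swap // scalerK.
Qed.
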